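(* Let $v>0$ and $\beta=(2\pi)^2 v$. Let $u^0=(u_1^0,u_2^0,u_3^0)$ be the initial vector field on $\mathbb{R}^3$ given by $$u_1^0=2\pi\sin(2\pi x_2)+2\pi\cos(2\pi x_3),\quad u_2^0=2\pi\sin(2\pi x_3)+2\pi\cos(2\pi x_1),\quad u_3^0=2\pi\sin(2\pi x_1)+2\pi\cos(2\pi x_2),$$ and let the external force $f_i(x,t)$ be identically zero for $1\le i\le 3$. Let $g:\mathbb{R}\to\mathbb{R}$ be any smooth function with $g(0)=g'(0)=0$. Then the functions $$u_1=e^{-\beta t}2\pi\big(\sin(2\pi(x_2+g(t)))+\cos(2\pi(x_3+g(t)))\big)-g'(t),$$ $$u_2=e^{-\beta t}2\pi\big(\sin(2\pi(x_3+g(t)))+\cos(2\pi(x_1+g(t)))\big)-g'(t),$$ $$u_3=e^{-\beta t}2\pi\big(\sin(2\pi(x_1+g(t)))+\cos(2\pi(x_2+g(t)))\big)-g'(t),$$ $$\begin{aligned}p=&-e^{-2\beta t}(2\pi)^2\sin(2\pi(x_1+g(t)))\cos(2\pi(x_2+g(t)))\\&-e^{-2\beta t}(2\pi)^2\sin(2\pi(x_2+g(t)))\cos(2\pi(x_3+g(t)))\\&-e^{-2\beta t}(2\pi)^2\sin(2\pi(x_3+g(t)))\cos(2\pi(x_1+g(t)))+g''(t)\sum_{j=1}^3x_j\end{aligned}$$ satisfy the Navier-Stokes system (momentum equation, divergence-free condition and initial condition $u(x,0)=u^0(x)$) on $\mathbb{R}^3\times[0,\infty)$ with viscosity $v$ and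 force $f$.
   Context: The Navier-Stokes system for an incompressible fluid on $\mathbb{R}^3$, with viscosity $v>0$, external force $f=(f_1,f_2,f_3)$, velocity $u=(u_1,u_2,u_3)$, pressure $p$ and initial field $u^0$, is: momentum equation $\frac{\partial u_i}{\partial t}+\sum_{j=1}^3u_j\frac{\partial u_i}{\partial x_j}=v\Delta u_i-\frac{\partial p}{\partial x_i}+f_i(x,t)$ for $x\in\mathbb{R}^3$, $t\ge0$, $1\le i\le3$; divergence-free condition $\sum_{i=1}^3\frac{\partial u_i}{\partial x_i}=0$ for $x\in\mathbb{R}^3$, $t\ge0$; initial condition $u(x,0)=u^0(x)$ for $x\in\mathbb{R}^3$. Here $\Delta=\sum_{i=1}^3\frac{\partial^2}{\partial x_i^2}$ is the Laplacian in the space variables, and the time derivative at $t=0$ is the limit as $t\to0^+$. *)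

(* Defs.v *)
From HB Require Import structures.
From mathcomp Require Import all_boot all_order all_algebra.
From mathcomp Require Import all_classical all_reals all_analysis.
Set Implicit Arguments.
Unset Strict Implicit.
Unset Printing Implicit Defensive.
Import Order.TTheory GRing.Theory Num.Theory.
Import numFieldNormedType.Exports.
Local Open Scope classical_set_scope.
Local Open Scope ring_scope.

(* Indices 1, 2, 3 of the mathematical text are the elements 0, 1, 2 of 'I_3;
   vectors of R^3 are rows, so the coordinate x_(i+1) is [x 0 i]. *)
Definition vec3 {R : realType} (a b c : R) : 'rV[R]_3 :=
  \row_(i < 3) [:: a; b; c]`_i.

Definition smooth {R : realType} (g : R -> R) : Prop :=
  forall (n : nat) (t : R), derivable (derive1n n g) t 1.

Definition basis3 (R : realType) (i : 'I_3) : 'rV[R]_3 := delta_mx 0 i.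

(* 'D_v is total, so the existence of every partial derivative that occurs in
   an equation has to be stated next to it, with [pderivable]. *)
Definition pderivable {R : realType} (i : 'I_3) (F : 'rV[R]_3 -> R)
    (x : 'rV[R]_3) : Prop :=
  derivable F x (basis3 R i).

Definition pderive {R : realType} (i : 'I_3) (F : 'rV[R]_3 -> R)
    (x : 'rV[R]_3) : R :=
  'D_(basis3 R i) F x.

Definition laplacian {R : realType} (F : 'rV[R]_3 -> R) (x : 'rV[R]_3) : R :=
  \sum_(i < 3) pderive i (pderive i F) x.

(* Derivative of [F] as a function on [0, +oo[: the increment h ranges over
   nonzero reals with 0 <= t + h. This is the two-sided derivative at t > 0 and
   the limit for h --> 0^+ at t = 0; values of [F] at negative times are not
   used. *)
Definition time_quotient {R : realType} (F : R -> R) (t h : R) : R :=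
  h^-1 * (F (t + h) - F t).

Definition time_increments {R : realType} (t : R) : set_system R :=
  within [set h | 0 <= t + h] 0^'.

Definition time_derivable {R : realType} (F : R -> R) (t : R) : Prop :=
  cvg (time_quotient F t @ time_increments t).

Definition time_derive {R : realType} (F : R -> R) (t : R) : R :=
  lim (time_quotient F t @ time_increments t).

(* Existence of all the derivatives appearing in the Navier-Stokes system. *)
Definition ns_derivable {R : realType} (u : 'rV[R]_3 -> R -> 'rV[R]_3)
    (p : 'rV[R]_3 -> R -> R) : Prop :=
  forall (x : 'rV[R]_3) (t : R), 0 <= t ->
  [/\ forall i : 'I_3, time_derivable (fun s => u x s 0 i) t,
      forall i j : 'I_3, pderivable j (fun y => u y t 0 i) x,
      forall i j : 'I_3, pderivable j (pderive j (fun y => u y t 0 i)) x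
    & forall i : 'I_3, pderivable i (fun y => p y t) x].

Definition momentum_equation {R : realType} (v : R)
    (f u : 'rV[R]_3 -> R -> 'rV[R]_3) (p : 'rV[R]_3 -> R -> R) : Prop :=
  forall (x : 'rV[R]_3) (t : R) (i : 'I_3), 0 <= t ->
  time_derive (fun s => u x s 0 i) t
    + \sum_(j < 3) u x t 0 j * pderive j (fun y => u y t 0 i) x
  = v * laplacian (fun y => u y t 0 i) x - pderive i (fun y => p y t) x
    + f x t 0 i.

Definition divergence_free {R : realType} (u : 'rV[R]_3 -> R -> 'rV[R]_3)
    : Prop :=
  forall (x : 'rV[R]_3) (t : R), 0 <= t ->
  \sum_(i < 3) pderive i (fun y => u y t 0 i) x = 0.

Definition initial_condition {R : realType} (u0 : 'rV[R]_3 -> 'rV[R]_3)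
    (u : 'rV[R]_3 -> R -> 'rV[R]_3) : Prop :=
  forall x : 'rV[R]_3, u x 0 = u0 x.

Definition navier_stokes {R : realType} (v : R)
    (f : 'rV[R]_3 -> R -> 'rV[R]_3) (u0 : 'rV[R]_3 -> 'rV[R]_3)
    (u : 'rV[R]_3 -> R -> 'rV[R]_3) (p : 'rV[R]_3 -> R -> R) : Prop :=
  [/\ ns_derivable u p, momentum_equation v f u p, divergence_free u
    & initial_condition u0 u].

(* Main.v *)
Require Import Defs.
From HB Require Import structures.
From mathcomp Require Import all_boot all_order all_algebra.
From mathcomp Require Import all_classical all_reals all_analysis.
From mathcomp Require Import ring.
Import Order.TTheory GRing.Theory Num.Theory.
Import numFieldNormedType.Exports.
Local Open Scope classical_set_scope.
Local Open Scope ring_scope.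

(** Write [W] for the field with components
    [W_i (z, t) = exp (- beta t) tau (sin (tau z_(i+1)) + cos (tau z_(i+2)))],
    indices being taken modulo 3. Each summand of [W_i] is a single wave of
    wave number [tau = 2 pi] in a coordinate other than [z_i], so [W] is
    divergence free, and [v * laplacian W = - v tau^2 W = - beta W = dW/dt]:
    [W] solves the heat equation. Moreover the convection term is a gradient:
    only [W_(i+1)] and [W_(i+2)] contribute to it, the product
    [sin (tau z_(i+2)) cos (tau z_(i+1))] occurs twice with opposite signs, and
      [sum_j W_j dW_i/dz_j = exp (- beta t)^2 tau^3
          (cos (tau z_i) cos (tau z_(i+1)) - sin (tau z_(i+2)) sin (tau z_i))],
    which is minus the [i]-th partial derivative of
      [P (z, t) = - exp (- beta t)^2 tau^2
          sum_j sin (tau z_j) cos (tau z_(j+1))].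
    Hence [(W, P)] is an exact solution, a decaying Beltrami flow.

    The field of the theorem is this solution seen from a frame translated by
    [g t] along [(1, 1, 1)]: [u (x, t) = W (x + g t, t) - g' t]. In the
    momentum equation the term [g' sum_j dW_i/dz_j] produced by the time
    derivative cancels the transport by [- g'], and the remaining [- g''] is
    balanced by the linear pressure term [g'' sum_j x_j].

    The equations are invariant under the cyclic shift of the coordinates.
    [vec3_cyclic] puts the three components into one formula indexed by
    ['I_3], whose addition is that of the integers modulo 3, and [big_cyclic3]
    starts every sum at the component under study, so that one computation
    serves all three components. *)

(** * Directional derivatives *)

Lemma derive_along_line {R : realType} {V W : normedModType R} (f : V -> W)
    (x w : V) (df : W) :
  is_derive (0 : R) 1 (fun h => f (h *: w + x)) df <-> is_derive x w f df.
Proof.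
suff E : 'D_1 (fun h : R => f (h *: w + x)) 0 = 'D_w f x.
  split=> -[Hd <-]; split; rewrite ?E //;
    exact/(derivable1P f x w).
rewrite /derive; congr (lim (nbhs (_ @ 0^'))).
by apply/funext => h /=; rewrite scale0r add0r addr0 [h *: 1]mulr1.
Qed.

(** A directional derivative only sees the restriction to a line, so the chain
    rule with a scalar inner function of a vector needs no differentiability
    beyond that direction. The same lemma covers the space variables and,
    with [V] the line, the time variable. *)
Lemma is_derive_comp {R : realType} {V : normedModType R} {phi : R -> R}
    {c : V -> R} {x w : V} {dphi dc : R} :
  is_derive (c x) 1 phi dphi -> is_derive x w c dc ->
  is_derive x w (phi \o c) (dphi * dc).
Proof.
move=> Hphi /derive_along_line Hc; apply/derive_along_line.
by apply: (is_derive1_comp (g := fun h => c (h *: w + x))); rewrite ?scale0r ?add0r.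
Qed.

Lemma is_derive_coord {R : realType} (n : nat) (j : 'I_n.+1)
    (x w : 'rV[R]_n.+1) :
  is_derive x w (fun y : 'rV[R]_n.+1 => y 0 j) (w 0 j).
Proof.
apply/derive_along_line.
have -> : (fun h : R => (h *: w + x) 0 j) = w 0 j \*: id + cst (x 0 j).
  by apply/funext => h; rewrite !mxE [RHS]/GRing.add /= mulrC.
by apply: is_derive_eq; rewrite addr0 [_ *: _]mulr1.
Qed.

Lemma is_derive_sinM {R : realType} {V : normedModType R} (k : R)
    {c : V -> R} {x w : V} {dc : R} :
  is_derive x w c dc ->
  is_derive x w (fun y => sin (k * c y)) (k * dc * cos (k * c x)).
Proof.
move=> /(is_deriveZ k) Hc.
apply: (is_derive_eq (is_derive_comp (is_derive_sin _) Hc)).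
by rewrite mulrC.
Qed.

Lemma is_derive_cosM {R : realType} {V : normedModType R} (k : R)
    {c : V -> R} {x w : V} {dc : R} :
  is_derive x w c dc ->
  is_derive x w (fun y => cos (k * c y)) (- (k * dc * sin (k * c x))).
Proof.
move=> /(is_deriveZ k) Hc.
apply: (is_derive_eq (is_derive_comp (is_derive_cos _) Hc)).
by rewrite mulrC mulrN.
Qed.

Lemma is_derive_expRM {R : realType} {V : normedModType R} (k : R)
    {c : V -> R} {x w : V} {dc : R} :
  is_derive x w c dc ->
  is_derive x w (fun y => expR (k * c y)) (k * dc * expR (k * c x)).
Proof.
move=> /(is_deriveZ k) Hc.
apply: (is_derive_eq (is_derive_comp (is_derive_expR _) Hc)).
by rewrite mulrC.
Qed.

Lemma is_derive_shifted_coord {R : realType} {n : nat} (j : 'I_n.+1)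
    (e : R) (x w : 'rV[R]_n.+1) :
  is_derive x w (fun y : 'rV[R]_n.+1 => y 0 j + e) (w 0 j).
Proof.
apply: (is_derive_eq (is_deriveD (is_derive_coord n j x w)
  (is_derive_cst e x w))).
by rewrite addr0.
Qed.

(** * The time derivative on the half line *)

(** The increments allowed at [t] form a subfilter of the punctured
    neighborhoods of 0, so the two-sided limit restricts to them; this filter is
    proper because, for [t >= 0], it contains all small positive increments,
    which gives uniqueness of the limit. *)
Lemma is_derive_time {R : realType} {F : R -> R} {t dF : R} : 0 <= t ->
  is_derive t 1 F dF -> time_derivable F t /\ time_derive F t = dF.
Proof.
move=> t0 [Hd HD].
have inc_proper : ProperFilter (time_increments t).
  split; last exact: within_filter.
  move=> /nbhs_ballP[e /= e0 He].
  have e2_gt0 : 0 < e / 2 by rewrite divr_gt0.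
  (* [e / 2] is a nonzero admissible increment in the ball of radius [e]. *)
  apply: (He (e / 2)).
  - rewrite /ball /= sub0r normrN gtr0_norm//.
    by rewrite ltr_pdivrMr// mulr_natr mulr2n ltrDl.
  - by rewrite gt_eqF.
  - exact: addr_ge0 t0 (ltW e2_gt0).
have cvF : time_quotient F t @ time_increments t --> dF.
  apply: cvg_within_filter; rewrite -HD /derive.
  suff -> : time_quotient F t =
     (fun h => h^-1 *: ((F \o shift t) (h *: 1) - F t)) by exact: Hd.
  by apply/funext => h; rewrite /time_quotient /= [h *: 1]mulr1 [h + t]addrC.
by split; [apply/cvg_ex; exists dF | exact: cvg_lim].
Qed.

(** * Cyclic indices *)

Lemma ord3_ind (P : 'I_3 -> Prop) : P 0 -> P 1 -> P 2 -> forall i, P i.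
Proof.
move=> P0 P1 P2 [[|[|[|//]]] Hi].
- by rewrite (_ : Ordinal Hi = 0) //; apply: val_inj.
- by rewrite (_ : Ordinal Hi = 1) //; apply: val_inj.
- by rewrite (_ : Ordinal Hi = 2) //; apply: val_inj.
Qed.

Lemma cyclic3_add (i : 'I_3) :
  (i + 1 + 1 = i + 2) * (i + 1 + 2 = i) * (i + 2 + 1 = i) * (i + 2 + 2 = i + 1).
Proof. by do !split; elim/ord3_ind: i; apply: val_inj. Qed.

Lemma cyclic3_eq (i : 'I_3) :
  ((i + 1 == i) = false) * ((i + 2 == i) = false) *
  ((i == i + 1) = false) * ((i == i + 2) = false) *
  ((i + 1 == i + 2) = false) * ((i + 2 == i + 1) = false).
Proof. by do !split; elim/ord3_ind: i. Qed.

(** The components of the velocity and of the initial field are all of the form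
    [W_(i+1, i+2)], with the pairs (1, 2), (2, 0), (0, 1) in this order. *)
Lemma vec3_cyclic {R : realType} (W : 'I_3 -> 'I_3 -> R) (i : 'I_3) :
  vec3 (W 1 2) (W 2 0) (W 0 1) 0 i = W (i + 1) (i + 2).
Proof. by elim/ord3_ind: i; rewrite mxE; congr W; apply: val_inj. Qed.

(** Starting the sum at [i] keeps the later computations free of any case
    analysis on the component. *)
Lemma big_cyclic3 {R : nmodType} (F : 'I_3 -> R) (i : 'I_3) :
  \sum_(j < 3) F j = F i + F (i + 1) + F (i + 2).
Proof.
have -> : \sum_(j < 3) F j = F 0 + F 1 + F 2.
  rewrite !big_ord_recl big_ord0 addr0 addrA.
  by congr (F _ + F _ + F _); apply: val_inj.
elim/ord3_ind: i.
- by congr (F _ + F _ + F _); apply: val_inj.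
- rewrite -addrA addrC; congr (F _ + F _ + F _); exact: val_inj.
- rewrite addrC addrA; congr (F _ + F _ + F _); exact: val_inj.
Qed.

(** * Derivatives of the velocity and of the pressure *)

Lemma basis3E {R : realType} (i j : 'I_3) : basis3 R i 0 j = (i == j)%:R.
Proof. by rewrite mxE eqxx eq_sym. Qed.

Lemma pderive_val {R : realType} {i : 'I_3} {F : 'rV[R]_3 -> R} {x : 'rV[R]_3}
    {dF : R} :
  is_derive x (basis3 R i) F dF -> pderive i F x = dF.
Proof. by case. Qed.

(** The spatial profile of one velocity component at a fixed time: [A] is the
    amplitude, [e] the displacement and [d] the speed of the moving frame. *)
Lemma is_derive_velocity {R : realType} (A k e d : R) (a b : 'I_3)
    (x w : 'rV[R]_3) :
  is_derive x w
    (fun y : 'rV[R]_3 => A * (sin (k * (y 0 a + e)) + cos (k * (y 0 b + e))) - d)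
    (A * k * (w 0 a * cos (k * (x 0 a + e)) - w 0 b * sin (k * (x 0 b + e)))).
Proof.
have Hs := is_derive_sinM k (is_derive_shifted_coord a e x w).
have Hc := is_derive_cosM k (is_derive_shifted_coord b e x w).
apply: (is_derive_eq (is_deriveB (is_deriveZ A (is_deriveD Hs Hc))
  (is_derive_cst d x w))).
by rewrite [_ *: _]/GRing.scale /=; ring.
Qed.

(** [p] and [q] stand for the components of the first direction of
    differentiation, so the function has the shape of the derivative found in
    [is_derive_velocity]. *)
Lemma is_derive_velocity_grad {R : realType} (A k e p q : R) (a b : 'I_3)
    (x w : 'rV[R]_3) :
  is_derive x w
    (fun y : 'rV[R]_3 =>
       A * (p * cos (k * (y 0 a + e)) - q * sin (k * (y 0 b + e))))
    (- (A * k * (p * w 0 a * sin (k * (x 0 a + e))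
                 + q * w 0 b * cos (k * (x 0 b + e))))).
Proof.
have Hc := is_derive_cosM k (is_derive_shifted_coord a e x w).
have Hs := is_derive_sinM k (is_derive_shifted_coord b e x w).
apply: (is_derive_eq (is_deriveZ A (is_deriveB (is_deriveZ p Hc)
  (is_deriveZ q Hs)))).
by rewrite ![_ *: _]/GRing.scale /=; ring.
Qed.

Lemma is_derive_pressure {R : realType} (A k e d : R) (x w : 'rV[R]_3) :
  is_derive x w
    (fun y : 'rV[R]_3 =>
       A * (\sum_(j < 3) sin (k * (y 0 j + e)) * cos (k * (y 0 (j + 1) + e)))
       + d * \sum_(j < 3) y 0 j)
    (A * k * (\sum_(j < 3)
       (w 0 j * cos (k * (x 0 j + e)) * cos (k * (x 0 (j + 1) + e))
        - w 0 (j + 1) * sin (k * (x 0 j + e)) * sin (k * (x 0 (j + 1) + e))))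
     + d * \sum_(j < 3) w 0 j).
Proof.
have Hs j := is_derive_sinM k (is_derive_shifted_coord j e x w).
have Hc j := is_derive_cosM k (is_derive_shifted_coord j e x w).
have H1 := is_derive_sum (fun j : 'I_3 => is_deriveM (Hs j) (Hc (j + 1))).
have H2 := is_derive_sum (fun j : 'I_3 => is_derive_coord _ j x w).
have := is_deriveD (is_deriveZ A H1) (is_deriveZ d H2).
rewrite !fct_sumE => H.
apply: (is_derive_eq H).
rewrite ![_ *: _]/GRing.scale /=; congr (_ + _).
rewrite -mulrA [k * _]mulr_sumr; congr (_ * _); apply: eq_bigr => j _.
by rewrite ![_ *: _]/GRing.scale /=; ring.
Qed.

(** The profile moves with [g] while its amplitude varies like [exp (l s)]; [h]
    will be the derivative of [g]. *)
Lemma is_derive_velocity_time {R : realType} (l A k c d t : R) (g h : R -> R) (dg dh : R) :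
  is_derive t 1 g dg -> is_derive t 1 h dh ->
  is_derive t 1
    (fun s => expR (l * s) * A * (sin (k * (c + g s)) + cos (k * (d + g s))) - h s)
    (expR (l * t) * A * (l * (sin (k * (c + g t)) + cos (k * (d + g t)))
       + k * dg * (cos (k * (c + g t)) - sin (k * (d + g t)))) - dh).
Proof.
move=> Hg Hh.
have He := is_derive_expRM l (is_derive_id t 1).
have Hs := is_derive_sinM k (is_deriveD (is_derive_cst c t 1) Hg).
have Hc := is_derive_cosM k (is_deriveD (is_derive_cst d t 1) Hg).
have H := is_deriveB
  (is_deriveM (is_deriveM He (is_derive_cst A t 1)) (is_deriveD Hs Hc)) Hh.
apply: (is_derive_eq H).
by rewrite ![_ *: _]/GRing.scale !fctE /= /cst; ring.
Qed.

(** * The exact solution *)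

Theorem lemma2p1 (R : realType) (v : R) (g : R -> R)
    (v_gt0 : 0 < v) (g_smooth : smooth g)
    (g0 : g 0 = 0) (g'0 : derive1 g 0 = 0) :
  let tau : R := 2 * pi in
  let beta : R := tau ^+ 2 * v in
  let x1 (x : 'rV[R]_3) : R := x 0 0 in
  let x2 (x : 'rV[R]_3) : R := x 0 1 in
  let x3 (x : 'rV[R]_3) : R := x 0 2 in
  let u0 (x : 'rV[R]_3) : 'rV[R]_3 :=
    vec3 (tau * sin (tau * x2 x) + tau * cos (tau * x3 x))
         (tau * sin (tau * x3 x) + tau * cos (tau * x1 x))
         (tau * sin (tau * x1 x) + tau * cos (tau * x2 x)) in
  let f (_ : 'rV[R]_3) (_ : R) : 'rV[R]_3 := 0 in
  let u (x : 'rV[R]_3) (t : R) : 'rV[R]_3 :=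
    vec3
      (expR (- beta * t) * tau *
         (sin (tau * (x2 x + g t)) + cos (tau * (x3 x + g t))) - derive1 g t)
      (expR (- beta * t) * tau *
         (sin (tau * (x3 x + g t)) + cos (tau * (x1 x + g t))) - derive1 g t)
      (expR (- beta * t) * tau *
         (sin (tau * (x1 x + g t)) + cos (tau * (x2 x + g t))) - derive1 g t) in
  let p (x : 'rV[R]_3) (t : R) : R :=
    - expR (- 2 * beta * t) * tau ^+ 2 *
        sin (tau * (x1 x + g t)) * cos (tau * (x2 x + g t))
    - expR (- 2 * beta * t) * tau ^+ 2 *
        sin (tau * (x2 x + g t)) * cos (tau * (x3 x + g t))
    - expR (- 2 * beta * t) * tau ^+ 2 *
        sin (tau * (x3 x + g t)) * cos (tau * (x1 x + g t))
    + derive1n 2 g t * \sum_(j < 3) x 0 j in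
  navier_stokes v f u0 u p.
Proof.
move=> tau beta x1 x2 x3 u0 f u p.
pose E (t : R) : R := expR (- beta * t).
have uE (y : 'rV[R]_3) (t : R) (i : 'I_3) : u y t 0 i = E t * tau *
    (sin (tau * (y 0 (i + 1) + g t)) + cos (tau * (y 0 (i + 2) + g t)))
    - derive1 g t.
  exact: (vec3_cyclic (fun a b => E t * tau *
    (sin (tau * (y 0 a + g t)) + cos (tau * (y 0 b + g t))) - derive1 g t)).
have pE y t : p y t = - E t ^+ 2 * tau ^+ 2 *
      (\sum_(j < 3) sin (tau * (y 0 j + g t)) * cos (tau * (y 0 (j + 1) + g t)))
    + derive1n 2 g t * \sum_(j < 3) y 0 j.
  rewrite /p (big_cyclic3 (fun j => _ * _) 0) !add0r.
  rewrite (_ : 1 + 1 = 2 :> 'I_3); last exact: val_inj.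
  rewrite (_ : 2 + 1 = 0 :> 'I_3); last exact: val_inj.
  (* The pressure is quadratic in the velocity, so it decays twice as fast. *)
  have -> : expR (- 2 * beta * t) = E t ^+ 2.
    by rewrite /E expr2 -expRD; congr expR; ring.
  by rewrite /x1 /x2 /x3; ring.
have u_fun i t : (fun y => u y t 0 i) = (fun y : 'rV[R]_3 => E t * tau *
    (sin (tau * (y 0 (i + 1) + g t)) + cos (tau * (y 0 (i + 2) + g t)))
    - derive1 g t) by apply/funext => y; exact: uE.
have du i j t y : is_derive y (basis3 R j) (fun y => u y t 0 i)
    (E t * tau * tau * ((j == i + 1)%:R * cos (tau * (y 0 (i + 1) + g t))
                        - (j == i + 2)%:R * sin (tau * (y 0 (i + 2) + g t)))).
  by rewrite u_fun; apply: (is_derive_eq (is_derive_velocity _ _ _ _ _ _ _ _));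
    rewrite !basis3E.
have du_fun i j t : pderive j (fun y => u y t 0 i) = (fun y : 'rV[R]_3 =>
    E t * tau * tau * ((j == i + 1)%:R * cos (tau * (y 0 (i + 1) + g t))
                       - (j == i + 2)%:R * sin (tau * (y 0 (i + 2) + g t)))).
  by apply/funext => y; exact: pderive_val (du i j t y).
have ddu i j t y : is_derive y (basis3 R j) (pderive j (fun y => u y t 0 i))
    (- (E t * tau * tau * tau *
       ((j == i + 1)%:R * (j == i + 1)%:R * sin (tau * (y 0 (i + 1) + g t))
        + (j == i + 2)%:R * (j == i + 2)%:R * cos (tau * (y 0 (i + 2) + g t))))).
  by rewrite du_fun;
    apply: (is_derive_eq (is_derive_velocity_grad _ _ _ _ _ _ _ _ _));
    rewrite !basis3E.
have dp i t y : is_derive y (basis3 R i) (fun y => p y t)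
    (- E t ^+ 2 * tau ^+ 2 * tau *
       (cos (tau * (y 0 i + g t)) * cos (tau * (y 0 (i + 1) + g t))
        - sin (tau * (y 0 (i + 2) + g t)) * sin (tau * (y 0 i + g t)))
     + derive1n 2 g t).
  rewrite (funext (fun z => pE z t)).
  apply: (is_derive_eq (is_derive_pressure _ _ _ _ _ _)).
  by rewrite !(big_cyclic3 _ i) !basis3E !cyclic3_add !cyclic3_eq !eqxx /=; ring.
have dt i (t : R) (y : 'rV[R]_3) : is_derive t 1 (fun s => u y s 0 i)
    (E t * tau *
       (- beta * (sin (tau * (y 0 (i + 1) + g t)) + cos (tau * (y 0 (i + 2) + g t)))
        + tau * derive1 g t *
          (cos (tau * (y 0 (i + 1) + g t)) - sin (tau * (y 0 (i + 2) + g t))))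
     - derive1n 2 g t).
  rewrite (funext (fun s => uE y s i)).
  have Hg : is_derive t 1 g (derive1 g t).
    by rewrite derive1E; apply/derivableP/(g_smooth 0%N).
  have Hg' : is_derive t 1 (derive1 g) (derive1n 2 g t).
    by rewrite /= derive1E; apply/derivableP/(g_smooth 1%N).
  exact: is_derive_velocity_time Hg Hg'.
split.
- move=> y t t0; split.
  + by move=> i; case: (is_derive_time t0 (dt i t y)).
  + by move=> i j; case: (du i j t y).
  + by move=> i j; case: (ddu i j t y).
  + by move=> i; case: (dp i t y).
- move=> y t i t0.
  have [_ ->] := is_derive_time t0 (dt i t y).
  rewrite (pderive_val (dp i t y)) /laplacian !(big_cyclic3 _ i).
  rewrite !(pderive_val (ddu i _ t y)) !du_fun !uE.
  by rewrite !cyclic3_add !cyclic3_eq !eqxx mxE /beta /=; ring.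
- move=> y t t0.
  rewrite (big_cyclic3 _ 0) !du_fun !cyclic3_add !cyclic3_eq /=.
  by ring.
- move=> y; apply/rowP => i.
  rewrite uE /E mulr0 expR0 g0 g'0 !addr0 subr0 mul1r.
  rewrite (vec3_cyclic (fun a b => tau * sin (tau * y 0 a) + tau * cos (tau * y 0 b))).
  by rewrite mulrDr.
Qed.
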